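(* Let $m,N\ge1$, let $X\subset\mathbb{R}^N$ be a nonempty closed convex set, $c\in\mathbb{R}^N$, and let $\xi=(\xi_1,\dots,\xi_m)^\top$ have mutually independent components $\xi_i\sim GH_1(\lambda_i,\chi_i,\psi_i,0,1,\varphi_i)$, where each $(\lambda_i,\chi_i,\psi_i)$ is admissible and $\varphi_i\in\mathbb{R}$; denote by $f_{\xi_i}$ and $F_{\xi_i}$ the density and distribution function of $\xi_i$. Let $r_i>0$ and assume that for each $i$ one of the following holds: (a) $\psi_i>0$; (b) $\psi_i=0$ and $\varphi_i<0$; (c) $\psi_i=0$, $\varphi_i>0$ and $r_i<-\lambda_i$; (d) $\psi_i=0$, $\varphi_i=0$, $\lambda_i<0$ and $r_i<-2\lambda_i$. Let $g=(g_1,\dots,g_m)^\top$ where each $g_i$ is $(-r_i)$-concave on $X$. Let $t_i^*>0$ be a threshold for the $(r_i+1)$-decreasing density of $\xi_i$. Define $$\Psi(x):=\sum_{i=1}^m\log F_{\xi_i}(g_i(x)),\qquad p^*:=\max_{1\le i\le m}F_{\xi_i}(t_i^* ),\qquad \mathcal D_p:=\{x\in X:\Psi(x)\ge\log p\}.$$ Then for every $p\in(p^*,1)$ the following hold. (1) The problem $\min c^\top x$ s.t. $\mathbb{P}(\xi\le g(x))\ge p$, $x\in X$, is equivalent to (has the same feasible set and objective as) $$\min_{x\in X}c^\top x\quad\text{subject to}\quad\Psi(x)\ge\log p. \qquad (\ast)$$ Moreover, $\Psi$ is concave on (the convex set) $\mathcal D_p$, and $(\ast)$ is a convex optimization problem.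 (2) If each $g_i$ is continuously differentiable, then for every $x$ such that $F_{\xi_i}(g_i(x))>0$ for all $i$, $$\nabla\Psi(x)=\sum_{i=1}^m\frac{f_{\xi_i}(g_i(x))}{F_{\xi_i}(g_i(x))}\,\nabla g_i(x).$$ (3) Moreover (with each $g_i$ continuously differentiable), if there exists $x^\circ\in\operatorname{ri}(X)$ with $\Psi(x^\circ)>\log p$, then a point $x^*\in X$ is optimal for $(\ast)$ if and only if there exists $\lambda^*\ge0$ such that $$0\in c-\lambda^*\nabla\Psi(x^* )+N_X(x^* ),\qquad \Psi(x^* )\ge\log p,\qquad \lambda^*\bigl(\Psi(x^* )-\log p\bigr)=0.$$ (4) Furthermore, define $v(\tau):=\inf\{c^\top x: x\in X,\ \Psi(x)\ge\tau\}$. For $\tau=\log p$ with $p\in(p^*,1)$, if $v$ is differentiable at $\tau$, then $v'(\tau)=\lambda^*(\tau)\ge0$, where $\lambda^*(\tau)$ is the optimal Lagrange multiplier associated with the constraint $\Psi(x)\ge\tau$ (i.e. the multiplier of the optimality system in (3), with $\log p=\tau$, at an optimal solution). For $\widetilde v(p):=v(\log p)$, whenever $v$ is differentiable at $\tau=\log p$, $$\frac{d\widetilde v}{dp}(p)=\frac{\lambda^*(\log p)}{p}\ge0.$$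
   Context: A function $f:\mathbb{R}\to\mathbb{R}$ is called $\alpha$-decreasing, for $\alpha\in\mathbb{R}$, if $f$ is continuous on $(0,+\infty)$ and there exists $t^*>0$ (a threshold) such that $t\mapsto t^\alpha f(t)$ is strictly decreasing on $(t^*,+\infty)$. Under the parameter conditions (a)–(d), the density of $\xi_i$ is $(r_i+1)$-decreasing, so a threshold $t_i^*$ exists. A function $f:\Omega\to[0,+\infty)$ on a set $\Omega\subset\mathbb{R}^N$ is $\alpha$-concave, $\alpha\in[-\infty,+\infty]$, if $f(\lambda x+(1-\lambda)y)\ge m_\alpha(f(x),f(y),\lambda)$ for all $x,y\in\Omega$, $\lambda\in[0,1]$, where $m_\alpha(a,b,\lambda)=0$ if $ab=0$, and for $a,b>0$: $m_0(a,b,\lambda)=a^\lambda b^{1-\lambda}$, $m_{+\infty}=\max\{a,b\}$, $m_{-\infty}=\min\{a,b\}$, and $m_\alpha(a,b,\lambda)=(\lambda a^\alpha+(1-\lambda)b^\alpha)^{1/\alpha}$ otherwise. In particular $(-r_i)$-concave functions take values in $[0,+\infty)$. The inequality $\xi\le g(x)$ is componentwise. $\operatorname{ri}(X)$ is the relative interior of $X$ and $N_X(x^* )=\{n\in\mathbb{R}^N: n^\top(x-x^* )\le0\ \forall x\in X\}$ is the normal cone of $X$ at $x^*$. ''Continuously differentiable'' for $g_i$ means on an open neighbourhood of $X$, so that the gradients $\nabla g_i(x)\in\mathbb{R}^N$, $x\in X$, make sense. $K_\nu$ ($\nu\in\mathbb{R}$) denotes the modified Bessel function of the third kind (also called of the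 second kind), $K_\nu(x)=\frac12\int_0^\infty u^{\nu-1}e^{-\frac{x}{2}(u+u^{-1})}\,du$, $x>0$. The triple $(\lambda,\chi,\psi)$ is admissible if: $\chi>0,\psi\ge0$ when $\lambda<0$; $\chi>0,\psi>0$ when $\lambda=0$; $\chi\ge0,\psi>0$ when $\lambda>0$. The generalized inverse Gaussian distribution $Gig(\lambda,\chi,\psi)$ has density on $(0,\infty)$ $$h(t)=\frac{\chi^{-\lambda}(\sqrt{\chi\psi})^{\lambda}}{2K_\lambda(\sqrt{\chi\psi})}\,t^{\lambda-1}\exp\!\left(-\tfrac12(\chi t^{-1}+\psi t)\right)$$ if $\chi,\psi>0$; for $\psi=0$ (so $\lambda<0,\chi>0$) it is the inverse gamma distribution with density $\left(\frac{\chi}{2}\right)^{-\lambda}\Gamma(-\lambda)^{-1}t^{\lambda-1}e^{-\chi/(2t)}$; for $\chi=0$ (so $\lambda>0,\psi>0$) it is the gamma distribution with density $\frac{(\psi/2)^\lambda}{\Gamma(\lambda)}t^{\lambda-1}e^{-\psi t/2}$. $GH_1(\lambda,\chi,\psi,\mu,\sigma^2,\varphi)$ ($\sigma>0$) is the law of $\mu+W\varphi+\sqrt{W}\,\sigma Z$ with $Z\sim\mathcal N(0,1)$ and $W\sim Gig(\lambda,\chi,\psi)$ independent. The density of $GH_1(\lambda,\chi,\psi,0,1,\varphi)$ is $f_\xi(t)=\int_0^\infty(2\pi\omega)^{-1/2}\exp\left(\varphi t-\frac{t^2}{2\omega}-\frac{\varphi^2\omega}{2}\right)h(\omega)\,d\omega$,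 where $h$ is the density of $W$.
   Formalization: In (2), the gradient formula is stated only at points x where every density value f_{ξ_i}(g_i(x)) is finite; it can be infinite when g_i(x)=0, χ_i=0 and λ_i≤1/2, and there the formula is meaningless and Ψ may fail to be differentiable. *)

(* Defs.v *)
From mathcomp Require Export all_boot all_order all_algebra.
From mathcomp Require Export all_classical all_reals all_analysis.

Set Implicit Arguments.
Unset Strict Implicit.
Unset Printing Implicit Defensive.

Import Order.TTheory GRing.Theory Num.Theory.
Export numFieldNormedType.Exports.

Local Open Scope classical_set_scope.
Local Open Scope ring_scope.

Section special_functions.
Context {R : realType}.

Definition Gamma (a : R) : R :=
  \int[lebesgue_measure]_(u in `]0%R, +oo[) (u `^ (a - 1) * expR (- u)).

Definition besselK (nu x : R) : R :=
  2^-1 * \int[lebesgue_measure]_(u in `]0%R, +oo[)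
           (u `^ (nu - 1) * expR (- (x / 2) * (u + u^-1))).

Definition gig_admissible (lam chi psi : R) : Prop :=
  [\/ [/\ lam < 0, 0 < chi & 0 <= psi],
      [/\ lam = 0, 0 < chi & 0 < psi] |
      [/\ 0 < lam, 0 <= chi & 0 < psi]].

Definition gig_pdf (lam chi psi t : R) : R :=
  if t <= 0 then 0
  else if psi == 0 then
    (chi / 2) `^ (- lam) / Gamma (- lam)
      * t `^ (lam - 1) * expR (- (chi / (2 * t)))
  else if chi == 0 then
    (psi / 2) `^ lam / Gamma lam * t `^ (lam - 1) * expR (- (psi * t / 2))
  else
    chi `^ (- lam) * Num.sqrt (chi * psi) `^ lam
      / (2 * besselK lam (Num.sqrt (chi * psi)))
      * t `^ (lam - 1) * expR (- 2^-1 * (chi * t^-1 + psi * t)).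

(* The normal-mixture formula is extended-real-valued: the integral is +oo at
   t = 0 when chi = 0 and lam <= 1/2, and finite everywhere else. *)
Definition gh_epdf (lam chi psi phi t : R) : \bar R :=
  (\int[lebesgue_measure]_(w in `]0%R, +oo[)
     ((2 * pi * w) `^ (- 2^-1)
        * expR (phi * t - t ^+ 2 / (2 * w) - phi ^+ 2 * w / 2)
        * gig_pdf lam chi psi w)%:E)%E.

Definition gh_pdf (lam chi psi phi t : R) : R :=
  fine (gh_epdf lam chi psi phi t).

End special_functions.

Section laws.
Context {R : realType} {d : measure_display} {T : measurableType d}.
Context {P : probability T R}.

Definition has_density (X : {RV P >-> R}) (f : R -> R) : Prop :=
  forall A : set R, measurable A ->
    distribution P X A = (\int[lebesgue_measure]_(t in A) (f t)%:E)%E.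

Definition independent2 (X Y : {RV P >-> R}) : Prop :=
  forall A B : set R, measurable A -> measurable B ->
    P (X @^-1` A `&` Y @^-1` B) = (P (X @^-1` A) * P (Y @^-1` B))%E.

Definition mutually_independent (I : finType) (X : I -> {RV P >-> R}) : Prop :=
  forall (J : {set I}) (A : I -> set R), (forall i, measurable (A i)) ->
    P (\bigcap_(i in [set` J]) X i @^-1` A i)
    = (\prod_(i in J) P (X i @^-1` A i))%E.

End laws.

(* X has the law of mu + W phi + sqrt W sigma Z. The pair (W, Z) may live on a
   probability space other than that of X. *)
Definition GH1_law {R : realType} {d : measure_display} {T : measurableType d}
    {P : probability T R} (X : {RV P >-> R})
    (lam chi psi mu sigma2 phi : R) : Prop :=
  exists (d' : measure_display) (T' : measurableType d')
         (P' : probability T' R) (W Z : {RV P' >-> R}),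
    [/\ has_density W (gig_pdf lam chi psi),
        has_density Z (normal_pdf 0 1),
        independent2 W Z &
        forall A : set R, measurable A ->
          distribution P X A
          = P' [set s | A (mu + W s * phi
                           + Num.sqrt (W s) * Num.sqrt sigma2 * Z s)] ].

Section generalized_concavity.
Context {R : realType}.

Definition gen_mean (alpha : \bar R) (a b l : R) : R :=
  if a * b == 0 then 0 else
  match alpha with
  | al%:E => if al == 0 then a `^ l * b `^ (1 - l)
             else (l * a `^ al + (1 - l) * b `^ al) `^ (al^-1)
  | +oo%E => Num.max a b
  | -oo%E => Num.min a b
  end.

Definition alpha_concave {V : lmodType R} (alpha : \bar R) (Omega : set V)
    (f : V -> R) : Prop :=
  (forall x, Omega x -> 0 <= f x) /\
  (forall x y (l : R), Omega x -> Omega y -> 0 <= l <= 1 ->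
     gen_mean alpha (f x) (f y) l <= f (l *: x + (1 - l) *: y)).

(* The continuity on (0, +oo) required of an alpha-decreasing function is not
   asked for again: the GH densities are continuous there. *)
Definition is_threshold (alpha : R) (f : R -> R) (ts : R) : Prop :=
  0 < ts /\
  (forall s t, ts < s -> s < t -> t `^ alpha * f t < s `^ alpha * f s).

End generalized_concavity.

Section convex_geometry.
Context {R : realType} {N : nat}.
Implicit Types (X : set 'rV[R]_N) (u v x y c : 'rV[R]_N).

Definition dot u v : R := (u *m v^T) 0 0.

Definition affine_hull X : set 'rV[R]_N :=
  [set y | exists (n : nat) (q : 'I_n -> 'rV[R]_N) (l : 'I_n -> R),
     [/\ forall i, X (q i), \sum_i l i = 1 & y = \sum_i l i *: q i] ].

Definition relint X : set 'rV[R]_N :=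
  [set x | X x /\ \forall y \near x, affine_hull X y -> X y].

Definition normal_cone X x : set 'rV[R]_N :=
  [set n | forall y, X y -> dot n (y - x) <= 0].

Definition grad (f : 'rV[R]_N -> R) x : 'rV[R]_N :=
  \row_j 'D_(delta_mx 0 j) f x.

Definition C1_on (U : set 'rV[R]_N) (f : 'rV[R]_N -> R) : Prop :=
  forall x, U x -> differentiable f x /\ {for x, continuous (grad f)}.

Definition concave_on (D : set 'rV[R]_N) (f : 'rV[R]_N -> R) : Prop :=
  convex_function D (fun x => - f x).

Record min_problem := MinProblem {
  objective : 'rV[R]_N -> R;
  feasible : set 'rV[R]_N }.

Definition optimal (pb : min_problem) x : Prop :=
  feasible pb x /\ forall y, feasible pb y -> objective pb x <= objective pb y.

Definition convex_problem (pb : min_problem) : Prop :=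
  convex_set (feasible pb) /\ convex_function (feasible pb) (objective pb).

Definition level_problem c X (Psi : 'rV[R]_N -> R) (tau : R) : min_problem :=
  MinProblem (dot c) [set x | X x /\ tau <= Psi x].

Definition kkt c X (Psi : 'rV[R]_N -> R) (tau : R) x (lam : R) : Prop :=
  [/\ 0 <= lam,
      exists2 n, normal_cone X x n & 0 = c - lam *: grad Psi x + n,
      tau <= Psi x &
      lam * (Psi x - tau) = 0].

Definition value_fun c X (Psi : 'rV[R]_N -> R) (tau : R) : \bar R :=
  ereal_inf [set (dot c x)%:E | x in [set x | X x /\ tau <= Psi x]].

End convex_geometry.

(* An extended-real-valued function is differentiable at t when it is finite
   around t and its real-valued restriction is differentiable at t. *)
Definition is_ederive {R : realType} (v : R -> \bar R) (t dv : R) : Prop :=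
  (\forall s \near t, v s \is a fin_num) /\
  is_derive t 1 (fun s => fine (v s)) dv.

Section chance_constraint.
Context {R : realType} {d : measure_display} {T : measurableType d}.
Context {P : probability T R} {m N : nat}.
Variables (xi : 'I_m -> {RV P >-> R}) (g : 'I_m -> 'rV[R]_N -> R).

Definition rcdf (Y : {RV P >-> R}) (t : R) : R := fine (cdf Y t).

(* [ln] vanishes on nonpositive reals; this junk value plays no role here, as
   the distribution function of a GH law is positive everywhere. *)
Definition Psi (x : 'rV[R]_N) : R := \sum_i ln (rcdf (xi i) (g i x)).

Definition chance_problem (c : 'rV[R]_N) (X : set 'rV[R]_N) (p : R) :
    @min_problem R N :=
  MinProblem (dot c)
    [set x | X x /\ (p%:E <= P [set s | forall i, (xi i s <= g i x)%R])%E].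

End chance_constraint.

(* Main.v *)
Require Import Defs.
From mathcomp Require Import measurable_realfun ring lra.

(** Write [F] for the distribution function of one component and [f] for its
    mixture density.  Conditionally on [W = w], the variable
    [W phi + sqrt W Z] is normal, so [F t] is the integral over [w] of
    [std_normal_cdf ((t - w phi) / sqrt w)] against the mixing density
    ([cdf_normal_mixture]).  Differentiating under the integral sign gives
    [F' = f] wherever [f] is finite ([is_derive_mixture_density]), in
    particular on the positive half-line, and [F] is positive everywhere
    ([mixture_cdf_gt0]).

    The threshold property says that [t ^ (r + 1) * f t] decreases beyond the
    threshold; up to the factor [- 1 / r] this is the derivative of
    [z |-> F (z ^ (- 1 / r))], which is therefore concave on the corresponding
    interval.  Since the power [- r] of a (- r)-concave function is convex,
    [F \o g] is concave between points where [g] exceeds the threshold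
    ([threshold_gen_mean_le]).  A level [ln p] with [p] above every
    [F_i (t_i)] forces [g_i > t_i] for all [i], because each factor of
    [\prod_i F_i (g_i x)] dominates the product ([level_gt_threshold]).  Hence
    [Psi] is concave on the level set, which is convex ([level_convex]), and
    independence identifies the level set with the chance constraint
    ([chance_problemE]).

    The optimality system is sufficient by the gradient inequality
    ([kkt_lower_bound]).  It is necessary because, where the constraint is
    tight, the images [(grad Psi . d, c . d)] of the displacements [d = y - xs]
    with [y] in [X] form a convex subset of the plane that avoids the open
    quadrant of displacements improving the objective while increasing the
    constraint; a strictly feasible point keeps the separating line from being
    vertical, and its slope is the multiplier ([kkt_necessary]).

    Finally, the gradient inequality holds on a slightly larger level set, so
    a multiplier at level [tau] is the slope of an affine minorant of the
    value function that touches it at [tau]; where the value function is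
    differentiable its derivative must be that slope
    ([value_fun_derive_multiplier]). *)

Set Implicit Arguments.
Unset Strict Implicit.
Unset Printing Implicit Defensive.

Import Order.TTheory GRing.Theory Num.Theory.
Local Open Scope classical_set_scope.
Local Open Scope ring_scope.

(** * The standard normal distribution function *)

Section normal_mixture.
Context {R : realType}.
Local Notation mu := (@lebesgue_measure R).

Definition std_normal_cdf (z : R) : R :=
  \int[mu]_(t in `]-oo, z]) normal_pdf 0 1 t.

Lemma std_normal_pdf_gt0 (z : R) : 0 < normal_pdf 0 1 z.
Proof.
rewrite normal_pdfE ?oner_eq0// mulr_gt0 ?expR_gt0//.
by rewrite normal_peak_gt0 ?oner_eq0.
Qed.

Lemma std_normal_cdfE (z : R) :
  (std_normal_cdf z)%:E = normal_prob 0 1 `]-oo, z].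
Proof.
rewrite /std_normal_cdf /Rintegral /normal_prob fineK//.
apply: integrable_fin_num => //.
exact: integrableS (integrable_normal_pdf 0 1).
Qed.

Lemma std_normal_cdf_le1 (z : R) : std_normal_cdf z <= 1.
Proof. by rewrite -lee_fin std_normal_cdfE probability_le1. Qed.

Lemma std_normal_cdf_homo : {homo std_normal_cdf : x y / x <= y}.
Proof.
move=> x y xy; rewrite -lee_fin !std_normal_cdfE le_measure ?inE//.
exact: subitvPr.
Qed.

(** A positive integrand has zero integral only over a null set, and half-lines
    have infinite measure. *)
Lemma std_normal_cdf_gt0 (z : R) : 0 < std_normal_cdf z.
Proof.
rewrite lt_neqAle -lee_fin std_normal_cdfE measure_ge0 andbT.
apply/eqP => /(congr1 (@EFin R)); rewrite std_normal_cdfE => /esym.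
rewrite /normal_prob => I0.
have mpdf : measurable_fun (`]-oo, z] : set R)
    (fun x : R => (normal_pdf 0 1 x)%:E).
  apply/measurable_funTS/measurableT_comp => //.
  exact: measurable_normal_pdf.
have /(ae_eq_integral_abs mu (measurable_itv _) mpdf) :
    (\int[mu]_(x in `]-oo, z]) `|(normal_pdf 0 1 x)%:E| = 0)%E.
  rewrite -[RHS]I0; apply: eq_integral => x _.
  by rewrite gee0_abs// lee_fin normal_pdf_ge0.
case=> A [mA A0 subA].
have : (mu `]-oo, z] <= mu A)%E.
  apply: le_measure; rewrite ?inE// => x zx; apply: subA => /= /(_ zx) [].
  by move/eqP; rewrite gt_eqF// std_normal_pdf_gt0.
by rewrite A0 lebesgue_measure_itv/= ltNyr addey.
Qed.

Lemma is_derive_std_normal_cdf (z : R) :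
  is_derive z 1 std_normal_cdf (normal_pdf 0 1 z).
Proof.
have [||||+ <-] := @continuous_FTC1 R (normal_pdf 0 1) -oo%O z (z + 1).
- by rewrite ltrDl.
- by apply: integrableS (integrable_normal_pdf 0 1).
- by rewrite ltNyr.
- by apply: continuous_normal_pdf; rewrite oner_eq0.
by move=> dF; rewrite derive1E; split.
Qed.

(** * Distribution function of a normal mean-variance mixture *)

(** The density at [t] of the normal law of mean [w * phi] and variance [w]. *)
Definition mixture_kernel (phi t w : R) : R :=
  (2 * pi * w) `^ (- 2^-1)
    * expR (phi * t - t ^+ 2 / (2 * w) - phi ^+ 2 * w / 2).

Lemma mixture_kernel_ge0 phi t w : 0 <= mixture_kernel phi t w.
Proof. by rewrite mulr_ge0 ?powR_ge0 ?expR_ge0. Qed.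

Lemma mixture_kernelE phi t w : 0 < w ->
  mixture_kernel phi t w =
  normal_pdf 0 1 ((t - w * phi) / Num.sqrt w) / Num.sqrt w.
Proof.
move=> w0; rewrite normal_pdfE ?oner_eq0// /normal_peak /normal_fun.
rewrite mulrAC; congr (_ * _).
  rewrite powRN powR12_sqrt; last by rewrite !mulr_ge0 ?pi_ge0// ltW.
  rewrite -invfM -sqrtrM; first by congr (Num.sqrt _)^-1; rewrite expr1n; ring.
  by rewrite expr1n mulrn_wge0// mul1r pi_ge0.
congr expR; rewrite subr0 exprMn exprVn sqr_sqrtr ?ltW// expr1n.
by field; rewrite gt_eqF.
Qed.

Lemma is_derive_mixture_kernel (phi t w : R) : 0 < w ->
  is_derive t 1 (fun s => std_normal_cdf ((s - w * phi) / Num.sqrt w))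
    (mixture_kernel phi t w).
Proof.
move=> w0; rewrite mixture_kernelE//.
have dA : is_derive t 1 (fun s : R => (s - w * phi) / Num.sqrt w)
    (Num.sqrt w)^-1.
  have -> : (fun s : R => (s - w * phi) / Num.sqrt w)
      = (Num.sqrt w)^-1 *: ((@id R) - cst (w * phi)).
    by apply/funext => s; rewrite !fctE mulrC.
  by apply: is_derive_eq; rewrite subr0 scaler1.
have dF := is_derive_std_normal_cdf ((t - w * phi) / Num.sqrt w).
exact: (@is_derive1_comp _ std_normal_cdf
  (fun s => (s - w * phi) / Num.sqrt w) _ _ _ dF dA).
Qed.

Lemma measurable_invr : measurable_fun [set: R] (@GRing.inv R).
Proof.
have -> : @GRing.inv R =
    fun w => if 0 <= w then w `^ (- 1) else - ((- w) `^ (- 1)).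
  apply/funext => w; case: ifPn => [w0|]; first by rewrite powR_inv1.
  by rewrite -ltNge => w0; rewrite powR_inv1 ?invrN ?opprK// oppr_ge0 ltW.
apply: measurable_fun_ifT.
- exact: measurable_fun_ler.
- exact: measurable_powR.
- apply: measurableT_comp => //.
  exact: measurableT_comp (measurable_powR _) _.
Qed.

Section mixture_cdf.
Variables (phi : R) (h : R -> R).
Hypothesis h_ge0 : forall w, 0 <= h w.
Hypothesis mh : measurable_fun [set: R] h.
Hypothesis inth : (\int[mu]_(w in `]0%R, +oo[) (h w)%:E = 1)%E.

(** The distribution function of [W * phi + sqrt W * Z], with [W] of density
    [h] and [Z] standard normal, obtained by conditioning on [W]. *)
Definition mixture_cdf (t : R) : R :=
  \int[mu]_(w in `]0%R, +oo[)
    (std_normal_cdf ((t - w * phi) / Num.sqrt w) * h w).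

Lemma integrable_mixing_density : mu.-integrable `]0, +oo[ (EFin \o h).
Proof.
apply/integrableP; split.
  by apply/measurable_funTS/measurableT_comp.
by under eq_integral do rewrite gee0_abs ?lee_fin//; rewrite inth ltry.
Qed.

Lemma measurable_normal_section t :
  measurable_fun [set: R]
    (fun w => std_normal_cdf ((t - w * phi) / Num.sqrt w)).
Proof.
apply: measurableT_comp.
  by apply: nondecreasing_measurable => //; exact: std_normal_cdf_homo.
apply: measurable_funM.
  by apply: measurable_funB => //; exact: measurable_funM.
apply: (measurableT_comp measurable_invr).
by apply: continuous_measurable_fun; exact: sqrt_continuous.
Qed.

Lemma integrable_mixture t : mu.-integrable `]0, +oo[
  (fun w => (std_normal_cdf ((t - w * phi) / Num.sqrt w) * h w)%:E).
Proof.
apply: (le_integrable _ _ _ integrable_mixing_density) => //.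
  apply/measurable_EFinP/measurable_funM; last exact: measurable_funTS.
  apply: measurable_funTS; exact: measurable_normal_section.
move=> w _ /=; have S0 := ltW (std_normal_cdf_gt0 ((t - w * phi) / Num.sqrt w)).
by rewrite lee_fin !ger0_norm ?mulr_ge0// ler_piMl ?std_normal_cdf_le1.
Qed.

Lemma is_derive_mixture_cdf (u v a : R) (G : R -> R) :
  a \in `]u, v[ -> (forall w, 0 <= G w) ->
  mu.-integrable `]0, +oo[ (EFin \o G) ->
  (forall t w : R, t \in `]u, v[ -> 0 < w ->
    mixture_kernel phi t w * h w <= G w) ->
  is_derive a 1 mixture_cdf
    (\int[mu]_(w in `]0%R, +oo[) (mixture_kernel phi a w * h w)).
Proof.
move=> auv G0 iG leG.
pose f t w := std_normal_cdf ((t - w * phi) / Num.sqrt w) * h w.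
have df (t w : R) : 0 < w ->
    is_derive t 1 (f ^~ w) (mixture_kernel phi t w * h w).
  move=> w0; rewrite /f.
  have -> : (fun s => std_normal_cdf ((s - w * phi) / Num.sqrt w) * h w) =
      h w *: (fun s => std_normal_cdf ((s - w * phi) / Num.sqrt w)).
    by apply/funext => s; rewrite fctE mulrC.
  have ? := is_derive_mixture_kernel phi t w0.
  by apply: is_derive_eq; rewrite mulrC.
have d1f (t w : R) : 0 < w ->
    partial1of2 f t w = mixture_kernel phi t w * h w.
  by move=> w0; rewrite partial1of2E; have [_ ->] := df t w w0.
have pos (w : R) : `]0, +oo[%classic w -> 0 < w by rewrite /= in_itv/= andbT.
have intf x : `]u, v[%classic x -> mu.-integrable `]0, +oo[ (EFin \o f x).
  by move=> _; exact: integrable_mixture.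
have derf (x w : R) : `]u, v[%classic x -> `]0, +oo[%classic w ->
    derivable (f ^~ w) x 1.
  by move=> _ /pos w0; have [] := df x w w0.
have ubf (x w : R) : `]u, v[%classic x -> `]0, +oo[%classic w ->
    `|partial1of2 f x w| <= G w.
  move=> xuv /pos w0.
  rewrite d1f// ger0_norm ?(mulr_ge0 (mixture_kernel_ge0 _ _ _))//.
  exact: leG.
have der := derivable_under_integral (mu := mu) (measurable_itv _)
  auv intf derf G0 iG ubf.
have := differentiation_under_integral (mu := mu) (measurable_itv _)
  auv intf derf G0 iG ubf.
rewrite derive1E => eqd; split; first exact: der.
rewrite -[LHS]/('D_1 (fun x => \int[mu]_(w in `]0%R, +oo[) f x w) a) eqd.
by apply: eq_Rintegral => w /set_mem/pos w0; rewrite d1f.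
Qed.

End mixture_cdf.
End normal_mixture.

Section mixture_density.
Context {R : realType}.
Local Notation mu := (@lebesgue_measure R).

Lemma measurable_mixture_kernel (phi t : R) :
  measurable_fun [set: R] (mixture_kernel phi t).
Proof.
apply: measurable_funM.
  by apply: (measurableT_comp (measurable_powR _)); exact: measurable_funM.
apply: measurableT_comp => //; apply: measurable_funB; last first.
  by apply: measurable_funM => //; exact: measurable_funM.
apply: measurable_funB => //; apply: measurable_funM => //.
by apply: (measurableT_comp measurable_invr); exact: measurable_funM.
Qed.

(** Near [t = 0] the kernel is controlled by its own value at [0], so that
    finiteness of the density at [0] is what provides domination there. *)
Lemma mixture_kernel_le_at0 (phi t w : R) : `|t| <= 1 -> 0 < w ->
  mixture_kernel phi t w <= expR `|phi| * mixture_kernel phi 0 w.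
Proof.
move=> t1 w0; rewrite /mixture_kernel mulrCA ler_wpM2l ?powR_ge0//.
rewrite -expRD ler_expR mulr0 expr0n/= mul0r subr0 add0r lerD2r.
rewrite lerBlDr (le_trans (ler_norm _))// normrM.
rewrite (@le_trans _ _ `|phi|) ?ler_piMr// lerDl.
by rewrite divr_ge0 ?sqr_ge0// mulr_ge0// ltW.
Qed.

(** Away from [t = 0] the factor [exp (- t ^ 2 / (2 w))] absorbs the
    singularity of [w ^ (- 1 / 2)] at [w = 0].  With [k = a ^ 2 / 8] the
    constant comes from [w ^ (- 1 / 2) <= 1 + 1 / w],
    [exp (- k / w) <= 1 / (1 + k / w)] and
    [1 + 1 / w <= (1 + 1 / k) * (1 + k / w)]. *)
Lemma mixture_kernel_bounded (phi a t w : R) : a != 0 ->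
  `|a| / 2 <= `|t| -> `|t| <= 2 * `|a| -> 0 < w ->
  mixture_kernel phi t w
  <= expR (`|phi| * (2 * `|a|)) * (1 + (a ^+ 2 / 8)^-1).
Proof.
move=> a0 at1 at2 w0; set k := a ^+ 2 / 8.
have k0 : 0 < k by rewrite divr_gt0// exprn_even_gt0.
have tk : k / w <= t ^+ 2 / (2 * w).
  rewrite invfM mulrA ler_wpM2r ?invr_ge0 ?(ltW w0)// /k.
  have : `|a| ^+ 2 <= 4 * `|t| ^+ 2 by have := normr_ge0 a; nra.
  by rewrite !real_normK ?num_real//; lra.
have e1 : expR (phi * t - t ^+ 2 / (2 * w) - phi ^+ 2 * w / 2)
    <= expR (`|phi| * (2 * `|a|)) * (1 + k / w)^-1.
  apply: (@le_trans _ _ (expR (`|phi| * (2 * `|a|)) * expR (- (k / w)))).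
    rewrite -expRD ler_expR lerBlDr.
    rewrite (@le_trans _ _ (`|phi| * (2 * `|a|) - k / w))//.
      rewrite lerB// (le_trans (ler_norm _))// normrM ler_wpM2l//.
    by rewrite lerDl divr_ge0// mulr_ge0 ?sqr_ge0// ltW.
  rewrite ler_wpM2l ?expR_ge0// expRN lef_pV2 ?expR_ge1Dx// posrE ?expR_gt0//.
  by rewrite addr_gt0// divr_gt0.
have e2 : (2 * pi * w) `^ (- 2^-1) <= 1 + w^-1.
  have pw : w < 2 * pi * w.
    by rewrite ltr_pMl//; have := pi_ge2 R; lra.
  have pw0 := lt_trans w0 pw.
  rewrite powRN powR12_sqrt ?(ltW pw0)//; set y := Num.sqrt _.
  have y0 : 0 < y by rewrite sqrtr_gt0.
  have yw : (y ^+ 2)^-1 <= w^-1.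
    by rewrite sqr_sqrtr ?(ltW pw0)// lef_pV2 ?posrE// ltW.
  apply: (@le_trans _ _ (1 + (y ^+ 2)^-1)); last by rewrite lerD2l.
  by rewrite -exprVn; nra.
apply: (le_trans (ler_pM (powR_ge0 _ _) (expR_ge0 _) e2 e1)).
rewrite mulrCA ler_wpM2l ?expR_ge0// ler_pdivrMr; last first.
  by rewrite addr_gt0// divr_gt0.
have -> : (1 + k^-1) * (1 + k / w) = (1 + w^-1) + (k / w + k^-1).
  by clearbody k; field; rewrite (gt_eqF k0) (gt_eqF w0).
by clearbody k; rewrite lerDl addr_ge0 ?invr_ge0 ?divr_ge0 ?(ltW k0) ?(ltW w0).
Qed.

Variables (phi : R) (h : R -> R).
Hypothesis h_ge0 : forall w, 0 <= h w.
Hypothesis mh : measurable_fun [set: R] h.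
Hypothesis inth : (\int[mu]_(w in `]0%R, +oo[) (h w)%:E = 1)%E.

Definition mixture_density (t : R) : \bar R :=
  (\int[mu]_(w in `]0%R, +oo[) (mixture_kernel phi t w * h w)%:E)%E.

Lemma integrable_mixing_densityZl (C : R) :
  mu.-integrable `]0, +oo[ (fun w => (C * h w)%:E).
Proof.
have iE : mu.-integrable `]0, +oo[ (fun w => (C%:E * (EFin \o h) w)%E).
  by apply: integrableZl => //; exact: integrable_mixing_density.
exact: iE.
Qed.

Lemma mixture_density_fin_num (a : R) :
  a != 0 -> mixture_density a \is a fin_num.
Proof.
move=> a0; apply: integrable_fin_num => //.
apply: le_integrable (integrable_mixing_densityZl
  (expR (`|phi| * (2 * `|a|)) * (1 + (a ^+ 2 / 8)^-1))) => //.
  apply/measurable_EFinP; apply: measurable_funTS.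
  by apply: measurable_funM => //; exact: measurable_mixture_kernel.
move=> w /=; rewrite in_itv/= andbT => w0; rewrite lee_fin.
rewrite ger0_norm ?mulr_ge0 ?powR_ge0 ?expR_ge0//.
rewrite (le_trans _ (ler_norm _))// ler_wpM2r//.
by apply: mixture_kernel_bounded => //; have := normr_ge0 a; lra.
Qed.

(** Differentiation under the integral sign, with the dominating function of
    [mixture_kernel_le_at0] at the origin and that of
    [mixture_kernel_bounded] elsewhere. *)
Lemma is_derive_mixture_density (a : R) : mixture_density a \is a fin_num ->
  is_derive a 1 (mixture_cdf phi h) (fine (mixture_density a)).
Proof.
move=> fin; have [a0|a0] := eqVneq a 0.
  subst a.
  pose K0 w := mixture_kernel phi 0 w * h w.
  have K0_ge0 w : 0 <= K0 w by rewrite mulr_ge0 ?mixture_kernel_ge0.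
  have iK0 : mu.-integrable `]0, +oo[ (EFin \o K0).
    apply/integrableP; split.
      apply/measurable_EFinP; apply: measurable_funTS.
      by apply: measurable_funM => //; exact: measurable_mixture_kernel.
    under eq_integral do rewrite gee0_abs ?lee_fin//.
    by move: fin; rewrite fin_numElt => /andP[].
  pose G w := expR `|phi| * K0 w.
  apply: (@is_derive_mixture_cdf _ phi h h_ge0 mh inth (- 1) 1 _ G).
  - by rewrite in_itv/= oppr_lt0 ltr01.
  - by move=> w; rewrite mulr_ge0 ?expR_ge0.
  - suff iE : mu.-integrable `]0, +oo[
        (fun w => (expR `|phi|)%:E * (EFin \o K0) w)%E.
      exact: iE.
    exact: integrableZl.
  - move=> t w; rewrite in_itv/= => /andP[t1 t2] w0.
    rewrite /G mulrA ler_wpM2r//.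
    by apply: mixture_kernel_le_at0 => //; rewrite ler_norml !ltW.
pose C := expR (`|phi| * (2 * `|a|)) * (1 + (a ^+ 2 / 8)^-1).
have na : 0 < `|a| by rewrite normr_gt0.
apply: (@is_derive_mixture_cdf _ phi h h_ge0 mh inth
  (a - `|a| / 2) (a + `|a| / 2) _ (fun w => C * h w)).
- by rewrite in_itv/=; lra.
- move=> w; rewrite mulr_ge0// mulr_ge0 ?expR_ge0// addr_ge0// invr_ge0.
  by rewrite divr_ge0// sqr_ge0.
- exact: integrable_mixing_densityZl.
- move=> t w; rewrite in_itv/= -ltr_distlC => ta w0; rewrite ler_wpM2r//.
  apply: mixture_kernel_bounded => //.
    by have := ler_distD t a 0; rewrite !subr0; lra.
  by have := ler_distD a t 0; rewrite !subr0 distrC; lra.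
Qed.

End mixture_density.

Section mixture_positive.
Context {R : realType}.
Local Notation mu := (@lebesgue_measure R).
Variables (phi : R) (h : R -> R).
Hypothesis h_ge0 : forall w, 0 <= h w.
Hypothesis mh : measurable_fun [set: R] h.
Hypothesis inth : (\int[mu]_(w in `]0%R, +oo[) (h w)%:E = 1)%E.

(** The integrand is the mixing density times a positive factor: if it had
    integral zero, then so would the mixing density. *)
Lemma mixture_cdf_gt0 (t : R) : 0 < mixture_cdf phi h t.
Proof.
pose k w := std_normal_cdf ((t - w * phi) / Num.sqrt w) * h w.
have k0 w : 0 <= k w by rewrite mulr_ge0// ltW// std_normal_cdf_gt0.
have ik : mu.-integrable `]0, +oo[ (fun w => (k w)%:E).
  exact: integrable_mixture.
have mk : measurable_fun (`]0, +oo[ : set R) (fun w : R => (k w)%:E).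
  exact: measurable_int ik.
rewrite lt_neqAle; apply/andP; split; last first.
  by apply: Rintegral_ge0 => w _; exact: k0.
apply/eqP => cdf0.
have abs0 : (\int[mu]_(w in `]0%R, +oo[) `|(k w)%:E| = 0)%E.
  under eq_integral do rewrite gee0_abs ?lee_fin//.
  rewrite -[LHS]fineK; last exact: integrable_fin_num ik.
  exact: (congr1 (@EFin R) (esym cdf0)).
have [A [mA A0 subA]] := (ae_eq_integral_abs mu (measurable_itv _) mk).1 abs0.
have h0 : (\int[mu]_(w in `]0%R, +oo[) (h w)%:E = 0)%E.
  rewrite -[RHS](integral0 mu (`]0%R, +oo[ : set R)).
  apply: ae_eq_integral => //.
    by apply/measurable_funTS/measurable_EFinP.
  exists A; split => // w nw; apply: subA => /= Dk; apply: nw => /= D.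
  have [/eqP] := Dk D; rewrite /k mulf_eq0 gt_eqF ?std_normal_cdf_gt0//=.
  by move/eqP ->.
by have := inth; rewrite h0 => /eqP; rewrite lt_eqF// lte_fin.
Qed.

End mixture_positive.

(** * Laws with a density and the mixture representation *)

Section density.
Context {R : realType} {d : measure_display} {T : measurableType d}.
Context {P : probability T R}.
Implicit Types W Z : {RV P >-> R}.
Local Notation mu := (@lebesgue_measure R).

Lemma borel_rv_subproof W : @measurable_fun _ _ T (measurableTypeR R) setT W.
Proof. exact: (@measurable_funPT _ _ T R W). Qed.

(** The real line carries two convertible Borel structures.  Random variables
    take values in the one, Lebesgue measure lives on the other, and a measure
    can be compared with Lebesgue measure only on the latter. *)
Definition borel_rv W : {mfun T >-> measurableTypeR R} :=
  @mfun_Sub _ _ T (measurableTypeR R) W (mem_set (borel_rv_subproof W)).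

Definition borel_law W : probability (measurableTypeR R) R :=
  distribution P (borel_rv W).

(** Two densities of one law agree almost everywhere, so the change of
    variables known for the Radon-Nikodym derivative holds for [h]. *)
Lemma ge0_integral_has_density W (h : R -> R) (f : R -> \bar R) :
  measurable_fun [set: R] h -> has_density W h ->
  measurable_fun [set: R] f -> (forall w, 0 <= f w)%E ->
  (\int[borel_law W]_w f w = \int[mu]_w (f w * (h w)%:E))%E.
Proof.
move=> mh Wh mf f0.
have mEh : measurable_fun [set: R] (EFin \o h) by exact/measurable_EFinP.
have lawE A : measurable A -> borel_law W A = (\int[mu]_(w in A) (h w)%:E)%E.
  exact: Wh.
have dom : borel_law W `<< mu.
  apply/null_content_dominatesP => A mA A0; rewrite lawE//.
  by apply: null_set_integral => //; exact: measurable_funTS.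
have iRN := Radon_Nikodym_SigmaFinite.f_integrable dom.
rewrite -(Radon_Nikodym_SigmaFinite.change_of_variables dom)//.
apply: ae_eq_integral => //.
- by apply: emeasurable_funM => //; exact: measurable_int iRN.
- exact: emeasurable_funM.
- apply: ae_eqe_mul2l; apply: integral_ae_eq => //.
  move=> E _ mE; rewrite -(Radon_Nikodym_SigmaFinite.f_integral dom)//.
  exact: lawE.
Qed.

Lemma independent2_joint_law W Z
    (A : set (measurableTypeR R * measurableTypeR R)) :
  independent2 W Z -> measurable A ->
  P [set s | A (W s, Z s)] = (borel_law W \x borel_law Z)%E A.
Proof.
move=> indep mA.
have mWZ : measurable_fun [set: T]
    (fun s => (borel_rv W s, borel_rv Z s)).
  by apply/measurable_fun_pair.
pose WZ : {mfun T >-> (measurableTypeR R * measurableTypeR R)%type} :=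
  mfun_Sub (mem_set mWZ).
by rewrite (@product_measure_unique _ _ _ _ _ _ _ (distribution P WZ)).
Qed.

(** The joint law of [(W, Z)] is a product, and the section at [w > 0] of the
    event is [Z <= (t - w * phi) / sqrt w].  The first component, that the
    mixing density has mass one, is read off from its being the density of a
    law. *)
Lemma cdf_normal_mixture W Z (h : R -> R) (phi t : R) :
  measurable_fun [set: R] h -> (forall w, 0 <= h w) ->
  (forall w, w <= 0 -> h w = 0) ->
  has_density W h -> has_density Z (normal_pdf 0 1) -> independent2 W Z ->
  (\int[mu]_(w in `]0%R, +oo[) (h w)%:E = 1)%E /\
  P [set s | 0 + W s * phi + Num.sqrt (W s) * Num.sqrt 1 * Z s <= t]
  = (mixture_cdf phi h t)%:E.
Proof.
move=> mh h0 hneg Wh Zn indep.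
have inth : (\int[mu]_(w in `]0%R, +oo[) (h w)%:E = 1)%E.
  rewrite -(@probability_setT _ _ _ (borel_law W)) [RHS]Wh//.
  rewrite integral_mkcond; apply: eq_integral => w _.
  rewrite /patch; case: ifPn => //; rewrite notin_setE/= in_itv/= andbT.
  by move/negP; rewrite -leNgt => w0; rewrite hneg.
split=> //.
pose A := [set wz : measurableTypeR R * measurableTypeR R |
  0 + wz.1 * phi + Num.sqrt wz.1 * Num.sqrt 1 * wz.2 <= t].
have mA : measurable A.
  have mb : measurable_fun setT
      (fun wz : measurableTypeR R * measurableTypeR R =>
        0 + wz.1 * phi + Num.sqrt wz.1 * Num.sqrt 1 * wz.2 <= t).
    apply: measurable_fun_ler => //; apply: measurable_funD.
      by apply: measurable_funD => //; apply: measurable_funM.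
    apply: measurable_funM => //; apply: measurable_funM => //.
    apply: measurableT_comp => //.
    by apply: continuous_measurable_fun; exact: sqrt_continuous.
  by have := mb measurableT [set true] I; rewrite setTI.
rewrite [LHS](independent2_joint_law indep mA) /product_measure1.
rewrite (ge0_integral_has_density mh Wh)//; last first.
  exact: measurable_fun_xsection.
rewrite /mixture_cdf /Rintegral fineK; last first.
  by apply: integrable_fin_num => //; exact: integrable_mixture.
rewrite [RHS]integral_mkcond; apply: eq_integral => w _.
rewrite /patch.
case: ifPn; rewrite ?inE ?notin_setE/= in_itv/= andbT; last first.
  by move/negP; rewrite -leNgt => w0; rewrite hneg// mule0.
move=> w0; rewrite EFinM std_normal_cdfE; congr (_ * _)%E.
rewrite [LHS]Zn; last exact: measurable_xsection.
congr (integral _ _ _); apply/seteqP; split=> z; rewrite /xsection/= inE /A/=.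
all: rewrite in_itv/= sqrtr1 mulr1 add0r.
all: by rewrite ler_pdivlMr ?sqrtr_gt0// lerBrDl (mulrC z).
Qed.

End density.

(** * Generalized inverse Gaussian mixing and GH laws *)

Section gig.
Context {R : realType}.
Variables (lam chi psi : R).

Lemma Gamma_ge0 (a : R) : 0 <= Gamma a.
Proof.
by apply: Rintegral_ge0 => u _; rewrite mulr_ge0 ?powR_ge0 ?expR_ge0.
Qed.

Lemma besselK_ge0 (nu x : R) : 0 <= besselK nu x.
Proof.
rewrite mulr_ge0//; apply: Rintegral_ge0 => u _.
by rewrite mulr_ge0 ?powR_ge0 ?expR_ge0.
Qed.

Lemma gig_pdf_ge0 (w : R) : 0 <= gig_pdf lam chi psi w.
Proof.
rewrite /gig_pdf; case: ifP => // _; case: ifP => _; [|case: ifP => _].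
all: by rewrite ?(besselK_ge0, Gamma_ge0, powR_ge0, expR_ge0, invr_ge0,
  mulr_ge0).
Qed.

Lemma gig_pdf_le0 (w : R) : w <= 0 -> gig_pdf lam chi psi w = 0.
Proof. by rewrite /gig_pdf => ->. Qed.

Lemma measurable_gig_pdf : measurable_fun [set: R] (gig_pdf lam chi psi).
Proof.
rewrite /gig_pdf; apply: measurable_fun_ifT => //.
  exact: measurable_fun_ler.
have mpow (c : R) : measurable_fun [set: R] (fun t : R => c * t `^ (lam - 1)).
  by apply: measurable_funM => //; exact: measurable_powR.
have minv (c : R) : measurable_fun [set: R] (fun t : R => chi * (c * t)^-1).
  apply: measurable_funM => //; apply: (measurableT_comp measurable_invr).
  exact: measurable_funM.
case: (psi == 0); [|case: (chi == 0)]; apply: measurable_funM => //.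
all: apply: measurableT_comp => //.
- exact: measurableT_comp (minv 2).
- by apply: measurableT_comp => //; exact: measurable_funM.
- apply: measurable_funM => //; apply: measurable_funD; last first.
    exact: measurable_funM.
  by apply: measurable_funM => //; exact: measurable_invr.
Qed.

End gig.

Section gh.
Context {R : realType} {d : measure_display} {T : measurableType d}.
Context {P : probability T R}.
Variables (X : {RV P >-> R}) (lam chi psi phi : R).
Hypothesis XGH : GH1_law X lam chi psi 0 1 phi.

Let gig := gig_pdf lam chi psi.

Lemma GH1_rcdf :
  (\int[lebesgue_measure]_(w in `]0%R, +oo[) (gig w)%:E = 1)%E /\
  rcdf X = mixture_cdf phi gig.
Proof.
have [d' [T' [P' [W [Z [Wh Zn indep XWZ]]]]]] := XGH.
have mixE t := cdf_normal_mixture phi t (measurable_gig_pdf lam chi psi)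
  (gig_pdf_ge0 lam chi psi) (@gig_pdf_le0 _ lam chi psi) Wh Zn indep.
split; first exact: (mixE 0).1.
apply/funext => t; rewrite /rcdf /cdf XWZ//.
rewrite -[RHS]/(fine (mixture_cdf phi gig t)%:E) -(mixE t).2.
by congr (fine (P' _)); apply/seteqP; split=> s /=; rewrite in_itv.
Qed.

Lemma GH1_rcdf_gt0 (t : R) : 0 < rcdf X t.
Proof.
have [inth ->] := GH1_rcdf.
by apply: mixture_cdf_gt0 => //; [exact: gig_pdf_ge0|exact: measurable_gig_pdf].
Qed.

Lemma is_derive_GH1_rcdf (t : R) : gh_epdf lam chi psi phi t \is a fin_num ->
  is_derive t 1 (rcdf X) (gh_pdf lam chi psi phi t).
Proof.
have [inth ->] := GH1_rcdf => fin.
apply: is_derive_mixture_density fin => //; first exact: gig_pdf_ge0.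
exact: measurable_gig_pdf.
Qed.

Lemma gh_epdf_fin_num (t : R) :
  t != 0 -> gh_epdf lam chi psi phi t \is a fin_num.
Proof.
have [inth _] := GH1_rcdf => t0.
apply: (@mixture_density_fin_num _ phi gig) => //; first exact: gig_pdf_ge0.
exact: measurable_gig_pdf.
Qed.

End gh.

(** * Concavity along generalized means *)

Section generalized_mean.
Context {R : realType}.

(** The mean value theorem on the two parts of the chord cut at the
    intermediate point: the mean slope of the left part is at least that of
    the right part. *)
Lemma concave_of_derive_nonincreasing (phi dphi : R -> R) (M : R) :
  (forall z, 0 < z < M -> is_derive z 1 phi (dphi z)) ->
  (forall y z, 0 < y -> y < z -> z < M -> dphi z <= dphi y) ->
  forall x y l, 0 < x < M -> 0 < y < M -> 0 <= l <= 1 ->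
    l * phi x + (1 - l) * phi y <= phi (l * x + (1 - l) * y).
Proof.
move=> der dec.
suff main x y l : 0 < x -> x < y -> y < M -> 0 < l < 1 ->
    l * phi x + (1 - l) * phi y <= phi (l * x + (1 - l) * y).
  move=> x y l /andP[x0 xM] /andP[y0 yM] /andP[l0 l1].
  have [->|ln0] := eqVneq l 0; first by rewrite !mul0r !add0r subr0 !mul1r.
  have [->|ln1] := eqVneq l 1; first by rewrite subrr !mul0r !addr0 !mul1r.
  have {ln0}l0 : 0 < l by rewrite lt_neqAle eq_sym ln0.
  have {ln1}l1 : l < 1 by rewrite lt_neqAle ln1.
  have [xy|yx|->] := ltgtP x y.
  - by apply: main => //; rewrite l0.
  - have := main y x (1 - l) y0 yx xM; rewrite subr_gt0 l1 gtrBl l0 => /(_ isT).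
    have -> : 1 - (1 - l) = l by ring.
    by rewrite addrC [X in _ <= phi X]addrC.
  - have e : l + (1 - l) = 1 by ring.
    by rewrite -!mulrDl e !mul1r.
move=> x0 xy yM /andP[l0 l1]; set z := l * x + (1 - l) * y.
have xz : x < z by rewrite /z; nra.
have zy : z < y by rewrite /z; nra.
have cont u v : 0 < u -> v < M -> {within `[u, v], continuous phi}.
  move=> u0 vM; apply: derivable_within_continuous => w.
  rewrite in_itv/= => /andP[uw wv].
  by have [|] := der w; rewrite // (lt_le_trans u0 uw) (le_lt_trans wv vM).
have dero u v : 0 < u -> v < M ->
    forall w, w \in `]u, v[ -> is_derive w 1 phi (dphi w).
  move=> u0 vM w; rewrite in_itv/= => /andP[uw wv].
  by apply: der; rewrite (lt_trans u0 uw) (lt_trans wv vM).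
have zM := lt_trans zy yM; have z0 := lt_trans x0 xz.
have [c1 c1i e1] := MVT xz (dero _ _ x0 zM) (cont _ _ x0 zM).
have [c2 c2i e2] := MVT zy (dero _ _ z0 yM) (cont _ _ z0 yM).
move: c1i c2i; rewrite !in_itv/= => /andP[xc1 c1z] /andP[zc2 c2y].
have c12 : dphi c2 <= dphi c1.
  apply: dec; first exact: lt_trans x0 xc1.
    exact: lt_trans c1z zc2.
  exact: lt_trans c2y yM.
have -> : phi z = l * phi x + (1 - l) * phi y
    + l * (1 - l) * (y - x) * (dphi c1 - dphi c2).
  have ez1 : z - x = (1 - l) * (y - x) by rewrite /z; ring.
  have ez2 : y - z = l * (y - x) by rewrite /z; ring.
  have -> : phi z = phi x + dphi c1 * (z - x) by rewrite -e1; ring.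
  have -> : phi y = phi x + dphi c1 * (z - x) + dphi c2 * (y - z).
    by rewrite -e1 -e2; ring.
  by rewrite ez1 ez2; ring.
rewrite lerDl mulr_ge0 ?subr_ge0// mulr_ge0 ?subr_ge0 ?(ltW xy)//.
by rewrite mulr_ge0 ?subr_ge0 ?(ltW l0) ?(ltW l1).
Qed.

Lemma gt0_ltr_powRN (q x y : R) : q < 0 -> 0 < x -> x < y -> y `^ q < x `^ q.
Proof.
move=> q0 x0 xy; have y0 := lt_trans x0 xy.
rewrite -[q]opprK (powRN x) (powRN y) ltf_pV2 ?posrE ?powR_gt0//.
by apply: gt0_ltr_powR; rewrite ?oppr_gt0 ?nnegrE ?ltW.
Qed.

(** In the coordinate [z = t ^ (- r)] the generalized mean is the arithmetic
    mean, so the claim is the concavity of [z |-> F (z ^ q)] with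
    [q = - 1 / r].  Its derivative is [q * (u ^ (r + 1) * f u)] at
    [u = z ^ q]: as [z] grows [u] decreases, [u ^ (r + 1) * f u] grows by the
    threshold property, and the factor [q] is negative. *)
Lemma threshold_gen_mean_le (F f : R -> R) (r ts a b l : R) :
  0 < r -> is_threshold (r + 1) f ts ->
  (forall t, ts < t -> is_derive t 1 F (f t)) ->
  ts < a -> ts < b -> 0 <= l <= 1 ->
  l * F a + (1 - l) * F b <= F (gen_mean (- r)%:E a b l).
Proof.
move=> r0 [ts0 dec] derF tsa tsb l01.
have a0 := lt_trans ts0 tsa; have b0 := lt_trans ts0 tsb.
rewrite /gen_mean mulf_eq0 (gt_eqF a0) (gt_eqF b0)/= oppr_eq0 (gt_eqF r0).
set q := (- r)^-1.
have q0 : q < 0 by rewrite invr_lt0 oppr_lt0.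
have rq : - r * q = 1 by rewrite mulfV// oppr_eq0 gt_eqF.
have powK x : 0 < x -> (x `^ (- r)) `^ q = x.
  by move=> x0; rewrite -powRrM rq powRr1 ?ltW.
have ltM x : ts < x -> 0 < x `^ (- r) < ts `^ (- r).
  by move=> tsx; rewrite powR_gt0 ?(lt_trans ts0)// gt0_ltr_powRN// oppr_lt0.
have gtts z : 0 < z < ts `^ (- r) -> ts < z `^ q.
  by move=> /andP[z0 zM]; rewrite -[ts in ts < _]powK// gt0_ltr_powRN.
have := @concave_of_derive_nonincreasing (fun z => F (z `^ q))
  (fun z => q * ((z `^ q) `^ (r + 1) * f (z `^ q))) (ts `^ (- r)) _ _
  (a `^ (- r)) (b `^ (- r)) l (ltM _ tsa) (ltM _ tsb) l01.
rewrite !powK//; apply.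
- move=> z zM; have /andP[z0 _] := zM.
  have dF := derF _ (gtts z zM); have dz := is_derive1_powR q z0.
  have := @is_derive1_comp _ F (fun z => z `^ q) z _ _ dF dz.
  congr (is_derive _ _ _ _); rewrite -powRrM mulrDr mulr1.
  have -> : q * r + q = q - 1 by rewrite -[1]rq; ring.
  by ring.
- move=> y z y0 yz zM; have z0 := lt_trans y0 yz.
  rewrite ler_nM2l// ltW// dec ?gtts ?z0//.
  exact: gt0_ltr_powRN.
Qed.

End generalized_mean.

(** * Optimality conditions for a concave constraint *)

Section concave_programming.
Context {R : realType} {N : nat}.
Implicit Types (X D : set 'rV[R]_N) (f Psi : 'rV[R]_N -> R) (c x y : 'rV[R]_N).

Lemma dotDr c x y : dot c (x + y) = dot c x + dot c y.
Proof. by rewrite /dot linearD mulmxDr mxE. Qed.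

Lemma dotZr c (l : R) x : dot c (l *: x) = l * dot c x.
Proof. by rewrite /dot linearZ -scalemxAr mxE. Qed.

Lemma dotBr c x y : dot c (x - y) = dot c x - dot c y.
Proof. by rewrite dotDr -scaleN1r dotZr mulN1r. Qed.

Lemma dotDl c c' x : dot (c + c') x = dot c x + dot c' x.
Proof. by rewrite /dot mulmxDl mxE. Qed.

Lemma dotZl (l : R) c x : dot (l *: c) x = l * dot c x.
Proof. by rewrite /dot -scalemxAl mxE. Qed.

Lemma dotNl c x : dot (- c) x = - dot c x.
Proof. by rewrite -scaleN1r dotZl mulN1r. Qed.

Lemma convex_setP X : convex_set X <->
  forall x y (l : R), X x -> X y -> 0 <= l <= 1 -> X (l *: x + (1 - l) *: y).
Proof.
split=> [cX x y l Xx Xy /andP[l0 l1]|cX x y l xX yX].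
  by have := cX x y (Itv01 l0 l1) (mem_set Xx) (mem_set Xy); rewrite inE.
by rewrite inE; apply: cX; rewrite ?ge0 ?le1//; exact: set_mem.
Qed.

Lemma concave_onP D f : concave_on D f <->
  forall x y (l : R), D x -> D y -> 0 <= l <= 1 ->
    l * f x + (1 - l) * f y <= f (l *: x + (1 - l) *: y).
Proof.
split=> [cf x y l Dx Dy /andP[l0 l1]|cf l x y xD yD].
  have := cf (Itv01 l0 l1) x y (mem_set Dx) (mem_set Dy).
  by rewrite convRE/= !mulrN -opprD lerN2.
rewrite convRE !mulrN -opprD lerN2.
by apply: cf; rewrite ?ge0 ?le1//; exact: set_mem.
Qed.

Lemma derive_grad f x v : differentiable f x -> 'D_v f x = dot (grad f x) v.
Proof.
move=> df; rewrite deriveE// [v in LHS]row_sum_delta linear_sum /dot mxE.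
apply: eq_bigr => j _; rewrite linearZ !mxE deriveE// mulrC.
by [].
Qed.

Lemma cvg_directional f x v : differentiable f x ->
  (fun h : R => h^-1 * (f (x + h *: v) - f x)) @ 0^'+ --> dot (grad f x) v.
Proof.
move=> df; rewrite -derive_grad//; apply: cvg_dnbhs_at_right.
have := @diff_derivable _ _ _ f x v df.
rewrite /derivable /derive => cf.
suff <- : (fun h : R => h^-1 *: ((f \o shift x) (h *: v) - f x)) =
  (fun h : R => h^-1 * (f (x + h *: v) - f x)) by exact: cf.
by apply/funext => h; rewrite /= (addrC (h *: v)).
Qed.

Lemma segment_pointE x y (h : R) : x + h *: (y - x) = h *: y + (1 - h) *: x.
Proof. by rewrite scalerBr scalerBl scale1r addrCA addrA. Qed.

Lemma concave_grad_le D f x y : concave_on D f -> D x -> D y ->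
  differentiable f x -> f y - f x <= dot (grad f x) (y - x).
Proof.
move=> /concave_onP cf Dx Dy df.
apply: (cvgr_to_ge (cvg_directional (v := y - x) df)).
near=> h; have h0 : 0 < h by near: h; exact: nbhs_right_gt.
have h1 : h <= 1 by near: h; apply: nbhs_right_le.
rewrite segment_pointE ler_pdivlMl//.
have := cf y x h Dy Dx; rewrite (ltW h0) h1 => /(_ isT).
by rewrite mulrBl mul1r; lra.
Unshelve. all: by end_near. Qed.

(** If the constraint is slack at [xs], or increases to first order towards
    [y], then the segment from [xs] to [y] starts inside the feasible set, and
    the objective cannot decrease along it. *)
Lemma optimal_feasible_direction c X Psi tau xs y :
  convex_set X -> X xs -> X y -> optimal (level_problem c X Psi tau) xs ->
  differentiable Psi xs ->
  tau < Psi xs \/ 0 < dot (grad Psi xs) (y - xs) -> 0 <= dot c (y - xs).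
Proof.
move=> /convex_setP cX Xxs Xy [[_ tauxs] opt] df dir.
have cvgq := cvg_directional (v := y - xs) df.
have : \forall h \near 0^'+, tau <= Psi (xs + h *: (y - xs)).
  case: dir => [tlt|a0].
    set a := dot (grad Psi xs) (y - xs) in cvgq.
    (* the quotients exceed [a - 1], so [Psi] drops by less than the slack *)
    near=> h; have h0 : 0 < h by near: h; exact: nbhs_right_gt.
    have : a - 1 < h^-1 * (Psi (xs + h *: (y - xs)) - Psi xs).
      by near: h; apply: (cvgr_gt _ cvgq); rewrite gtrBl.
    have a1 : 0 < `|a| + 1 by rewrite ltr_wpDl.
    have : h < (Psi xs - tau) / (`|a| + 1).
      by near: h; apply: nbhs_right_lt; rewrite divr_gt0 ?subr_gt0.
    rewrite ltr_pdivlMr// ltr_pdivlMl//.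
    have := ler_norm (- a); rewrite normrN => aN.
    have : h * - a <= h * `|a| by rewrite ler_wpM2l// ltW.
    lra.
  near=> h; have h0 : 0 < h by near: h; exact: nbhs_right_gt.
  rewrite (le_trans tauxs)// -subr_ge0.
  rewrite -(pmulr_rge0 _ (_ : 0 < h^-1)) ?invr_gt0//.
  by apply: ltW; near: h; exact: (cvgr_gt _ cvgq).
move=> nearP; have [h [h0 h1 hP]] : exists h, [/\ 0 < h, h <= 1 &
    tau <= Psi (xs + h *: (y - xs))].
  near (0 : R)^'+ => h; exists h; split.
  - by near: h; exact: nbhs_right_gt.
  - by near: h; exact: nbhs_right_le.
  - by near: h.
have : X (xs + h *: (y - xs)).
  by rewrite segment_pointE; apply: cX; rewrite ?(ltW h0).
move=> Xh; have := opt _ (conj Xh hP); rewrite /= dotDr dotZr lerDl => hc.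
by rewrite -(pmulr_rge0 _ h0).
Unshelve. all: by end_near. Qed.

(** Where the constraint is tight, the objective and the linearized constraint
    are separated on the plane: the multiplier is the infimum of the slopes
    [dot c (y - xs) / dot (grad Psi xs) (y - xs)] over the directions in which
    the constraint increases, and the strictly feasible point [x0] provides
    such a direction. *)
Lemma kkt_necessary c X Psi tau x0 xs : convex_set X ->
  concave_on [set x | X x /\ tau <= Psi x] Psi ->
  X x0 -> tau < Psi x0 -> X xs -> differentiable Psi xs ->
  optimal (level_problem c X Psi tau) xs ->
  exists ls, kkt c X Psi tau xs ls.
Proof.
move=> cX cPsi Xx0 tau0 Xxs df opt.
have tauxs : tau <= Psi xs by case: opt => -[].
have feas y Xy :=
  @optimal_feasible_direction c X Psi tau xs y cX Xxs Xy opt df.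
have [tlt|] := ltP tau (Psi xs).
  exists 0; split; rewrite ?mul0r//; exists (- c).
    by move=> y Xy; rewrite dotNl oppr_le0; apply: feas => //; left.
  by rewrite scale0r subr0 subrr.
move=> /(conj tauxs)/andP/le_anti tauE.
set G := grad Psi xs in feas *.
pose a y := dot G (y - xs); pose b y := dot c (y - xs).
have a0 : 0 < a x0.
  apply: (@lt_le_trans _ _ (Psi x0 - Psi xs)); first by rewrite -tauE subr_gt0.
  by apply: (concave_grad_le cPsi) => //; split=> //; exact: ltW.
have b_ge0 y : X y -> 0 < a y -> 0 <= b y.
  by move=> Xy ay; apply: feas => //; right.
have mixE k x y e : dot k (e *: x + (1 - e) *: y - xs) =
    e * dot k (x - xs) + (1 - e) * dot k (y - xs).
  by rewrite !dotBr dotDr !dotZr; ring.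
have Xmix x y e : X x -> X y -> 0 <= e <= 1 -> X (e *: x + (1 - e) *: y).
  by move/convex_setP : cX; exact.
(* moving slightly towards [x0] makes the constraint increase; the weight [e]
   halves a negative value of [b] *)
have b_ge0w y : X y -> 0 <= a y -> 0 <= b y.
  move=> Xy ay; rewrite leNgt; apply/negP => by0.
  have bx0 := b_ge0 _ Xx0 a0.
  have d0 : 0 < b x0 - b y by lra.
  pose e := - b y / (2 * (b x0 - b y)).
  have e0 : 0 < e by rewrite divr_gt0 ?oppr_gt0 ?mulr_gt0.
  have e1 : e < 1 by rewrite ltr_pdivrMr ?mulr_gt0// mul1r; lra.
  have := b_ge0 (e *: x0 + (1 - e) *: y).
  rewrite /a /b !mixE -/(a x0) -/(a y) -/(b x0) -/(b y).
  have eb : e * (b x0 - b y) = - b y / 2.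
    by rewrite /e; field; rewrite gt_eqF.
  have -> : e * b x0 + (1 - e) * b y = b y / 2.
    apply: (@eq_trans _ _ (b y + e * (b x0 - b y))); first by ring.
    by rewrite eb; field.
  move=> /(_ (Xmix _ _ _ Xx0 Xy _)); rewrite (ltW e0) (ltW e1) => /(_ isT).
  have ea : 0 < e * a x0 + (1 - e) * a y.
    clearbody e; rewrite ltr_pwDl ?mulr_gt0 ?mulr_ge0//.
    by rewrite subr_ge0 ltW.
  by move=> /(_ ea); lra.
pose S := [set q | exists2 y, X y /\ 0 < a y & q = b y / a y].
have S0 : nonempty S by exists (b x0 / a x0), x0.
have Slb : lbound S 0.
  by move=> _ [y [Xy ay] ->]; rewrite divr_ge0 ?b_ge0// ltW.
pose ls := inf S.
exists ls; split => //.
- exact: lb_le_inf.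
- exists (- c + ls *: G); last first.
    by rewrite -/G addrACA subrr addNr addr0.
  move=> y Xy; rewrite dotDl dotNl dotZl -/(a y) -/(b y) addrC subr_le0.
  have [ay|ay|ay] := ltgtP (a y) 0; last 2 first.
  + by rewrite -ler_pdivlMr//; apply: ge_inf; [exists 0|exists y].
  + by rewrite ay mulr0 b_ge0w// ay.
  (* mix [y] with a point [z] of positive [a] so that [a] vanishes *)
  rewrite mulrC -ler_ndivrMl//; apply: lb_le_inf => // _ [z [Xz az] ->].
  have d0 : 0 < a z - a y by lra.
  pose e := - a y / (a z - a y).
  have e01 : 0 <= e <= 1.
    apply/andP; split; last by rewrite /e ler_pdivrMr// mul1r; lra.
    by apply: divr_ge0; rewrite ?oppr_ge0 ltW.
  have ed : e * (a z - a y) = - a y by rewrite /e; field; rewrite gt_eqF.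
  have := b_ge0w _ (Xmix _ _ _ Xz Xy e01).
  rewrite /a /b !mixE -/(a z) -/(a y) -/(b z) -/(b y).
  have -> : e * a z + (1 - e) * a y = 0.
    apply: (@eq_trans _ _ (a y + e * (a z - a y))); first by ring.
    by rewrite ed; ring.
  move=> /(_ (lexx 0)).
  have -> : e * b z + (1 - e) * b y = (b y * a z - a y * b z) / (a z - a y).
    by rewrite /e; field; rewrite gt_eqF.
  rewrite pmulr_lge0 ?invr_gt0// subr_ge0 => le1.
  by rewrite ler_pdivlMr// -mulrA ler_ndivrMl.
- by rewrite tauE subrr mulr0.
Qed.

(** The gradient inequality turns a multiplier into a lower bound of the
    objective over all of the larger set where [Psi] is concave, not only
    over the feasible set. *)
Lemma kkt_lower_bound c X Psi tau s xs ls y : s <= tau ->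
  concave_on [set x | X x /\ s <= Psi x] Psi ->
  X xs -> differentiable Psi xs ->
  kkt c X Psi tau xs ls -> X y -> s <= Psi y ->
  dot c xs + ls * (Psi y - tau) <= dot c y.
Proof.
move=> stau cPsi Xxs df [ls0 [n nX eqn] tauxs compl] Xy sy.
have := nX _ Xy; have -> : n = ls *: grad Psi xs - c.
  by apply/eqP; rewrite -subr_eq0 opprB addrC -eqn.
rewrite dotDl dotNl dotZl.
have : ls * (Psi y - Psi xs) <= ls * dot (grad Psi xs) (y - xs).
  rewrite ler_wpM2l//; apply: (concave_grad_le cPsi) => //.
  by split=> //; exact: le_trans tauxs.
rewrite (dotBr c).
have : ls * (Psi y - Psi xs) = ls * (Psi y - tau).
  by rewrite -[RHS]subr0 -compl; ring.
lra.
Qed.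

Lemma kkt_optimal c X Psi tau xs ls :
  concave_on [set x | X x /\ tau <= Psi x] Psi ->
  X xs -> differentiable Psi xs ->
  kkt c X Psi tau xs ls -> optimal (level_problem c X Psi tau) xs.
Proof.
move=> cPsi Xxs df K; have [ls0 _ tauxs _] := K.
split=> // y [Xy tauy]; have := kkt_lower_bound (lexx _) cPsi Xxs df K Xy tauy.
by apply: le_trans; rewrite lerDl mulr_ge0// subr_ge0.
Qed.

End concave_programming.

(** * The value function *)

Section value_function.
Context {R : realType} {N : nat}.
Implicit Types (X : set 'rV[R]_N) (Psi : 'rV[R]_N -> R) (c : 'rV[R]_N).

Lemma is_derive_quotient (F : R -> R) (t dv : R) : is_derive t 1 F dv ->
  (fun h => h^-1 * (F (t + h) - F t)) @ 0^' --> dv.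
Proof.
move=> [dF <-].
suff <- : (fun h : R => h^-1 *: ((F \o shift t) (h *: 1) - F t)) =
  (fun h : R => h^-1 * (F (t + h) - F t)) by exact: dF.
by apply/funext => h; rewrite /= (addrC _ t) [h%:A]mulr1.
Qed.

Lemma derive_ge_slope (F : R -> R) (t dv k : R) : is_derive t 1 F dv ->
  (\forall h \near 0^'+, F t + k * h <= F (t + h)) -> k <= dv.
Proof.
move=> /is_derive_quotient/cvg_dnbhs_at_right dF nearF.
apply: (cvgr_to_ge dF); near=> h.
have h0 : 0 < h by near: h; exact: nbhs_right_gt.
rewrite ler_pdivlMl// lerBrDl mulrC; near: h; exact: nearF.
Unshelve. all: by end_near. Qed.

Lemma derive_le_slope (F : R -> R) (t dv k : R) : is_derive t 1 F dv ->
  (\forall h \near 0^'-, F t + k * h <= F (t + h)) -> dv <= k.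
Proof.
move=> /is_derive_quotient/cvg_dnbhs_at_left dF nearF.
apply: (cvgr_to_le dF); near=> h.
have h0 : h < 0 by near: h; exact: nbhs_left_lt.
rewrite ler_ndivrMl// lerBrDl mulrC; near: h; exact: nearF.
Unshelve. all: by end_near. Qed.

Lemma value_fun_homo c X Psi (s t : R) : s <= t ->
  (value_fun c X Psi s <= value_fun c X Psi t)%E.
Proof.
move=> st; apply: ereal_inf_le_tmp => _ [y [Xy ty] <-].
by exists y => //; split=> //; exact: le_trans ty.
Qed.

Lemma near_translate (t : R) (Q : R -> Prop) :
  (\forall s \near t, Q s) -> \forall h \near 0, Q (t + h).
Proof.
move=> nQ; have : (fun h : R => t + h) @ 0 --> t.
  by rewrite -[X in _ --> X]addr0; apply: cvgD; [exact: cvg_cst|exact: cvg_id].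
exact.
Qed.

Lemma value_fun_derive_ge0 c X Psi (tau dv : R) :
  is_ederive (value_fun c X Psi) tau dv -> 0 <= dv.
Proof.
move=> [fin /derive_ge_slope]; apply.
have tfin := nbhs_singleton fin.
have fin0 := near_translate fin.
near=> h; have h0 : 0 < h by near: h; exact: nbhs_right_gt.
rewrite mul0r addr0 fine_le//.
  by near: h; exact: cvg_at_right_filter fin0.
by apply: value_fun_homo; rewrite lerDl ltW.
Unshelve. all: by end_near. Qed.

(** A finite value just above the level means a nonempty feasible set there,
    that is a strictly feasible point. *)
Lemma value_fun_slater c X Psi (tau dv : R) :
  is_ederive (value_fun c X Psi) tau dv -> exists2 x0, X x0 & tau < Psi x0.
Proof.
move=> [/near_translate fin _].
have [h [h0 hfin]] : exists h,
    0 < h /\ value_fun c X Psi (tau + h) \is a fin_num.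
  near (0 : R)^'+ => h; exists h; split; first by near: h; exact: nbhs_right_gt.
  by near: h; exact: cvg_at_right_filter fin.
have [_ [x [Xx sx] _] _] := lb_ereal_inf_adherent ltr01 hfin.
by exists x => //; apply: lt_le_trans sx; rewrite ltrDl.
Unshelve. all: by end_near. Qed.

Lemma value_fun_optimal c X Psi (tau : R) xs :
  optimal (level_problem c X Psi tau) xs ->
  value_fun c X Psi tau = (dot c xs)%:E.
Proof.
move=> [feas opt]; apply/eqP; rewrite eq_le; apply/andP; split.
  by apply: ereal_inf_lbound; exists xs.
by apply: le_ereal_inf_tmp => _ [y fy <-]; rewrite lee_fin; exact: opt.
Qed.

(** A multiplier is the slope of an affine minorant of the value function that
    touches it at the level, on both sides of it. *)
Lemma value_fun_derive_multiplier c X Psi (s0 tau dv ls : R) xs : s0 < tau ->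
  concave_on [set x | X x /\ s0 <= Psi x] Psi ->
  X xs -> differentiable Psi xs ->
  optimal (level_problem c X Psi tau) xs -> kkt c X Psi tau xs ls ->
  is_ederive (value_fun c X Psi) tau dv -> dv = ls.
Proof.
move=> s0tau cPsi Xxs df opt K [fin dF].
have ls0 : 0 <= ls by case: K.
have fin0 := near_translate fin.
have minorant h : s0 <= tau + h ->
    ((dot c xs + ls * h)%:E <= value_fun c X Psi (tau + h))%E.
  move=> s0h; apply: le_ereal_inf_tmp => _ [y [Xy hy] <-]; rewrite lee_fin.
  have := kkt_lower_bound (ltW s0tau) cPsi Xxs df K Xy (le_trans s0h hy).
  by apply: le_trans; rewrite lerD2l ler_wpM2l// lerBrDl.
have near_min : \forall h \near 0, fine (value_fun c X Psi tau) + ls * h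
    <= fine (value_fun c X Psi (tau + h)).
  near=> h; have hfin : value_fun c X Psi (tau + h) \is a fin_num.
    by near: h; exact: fin0.
  rewrite (value_fun_optimal opt) -lee_fin [leRHS]fineK//; apply: minorant.
  rewrite -lerBlDl; apply: ltW; near: h; apply: lt_nbhsr.
  by rewrite subr_lt0.
apply/eqP; rewrite eq_le; apply/andP; split.
- by apply: (derive_le_slope dF); exact: cvg_at_left_filter near_min.
- by apply: (derive_ge_slope dF); exact: cvg_at_right_filter near_min.
Unshelve. all: by end_near. Qed.

Lemma is_ederive_comp_ln (v : R -> \bar R) (p dv : R) : 0 < p ->
  is_ederive v (ln p) dv -> is_ederive (fun q => v (ln q)) p (dv / p).
Proof.
move=> p0 [fin dF]; split.
  have /differentiable_continuous cln : differentiable (@ln R) p.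
    by apply/derivable1_diffP; have [] := is_derive1_ln p0.
  exact: cln fin.
apply: (@is_derive1_comp _ (fun s => fine (v s)) (@ln R)).
exact: is_derive1_ln.
Qed.

End value_function.

(** * The sum of log-distribution functions *)

Lemma ln_prod_gt0 (R : realType) (I : finType) (A : pred I) (F : I -> R) :
  (forall i, 0 < F i) -> ln (\prod_(i | A i) F i) = \sum_(i | A i) ln (F i).
Proof.
move=> F0; suff [] : 0 < \prod_(i | A i) F i /\
    ln (\prod_(i | A i) F i) = \sum_(i | A i) ln (F i) by [].
elim/big_rec2: _ => [|i u v _ [u0 <-]]; first by rewrite ln1.
by rewrite mulr_gt0// lnM ?posrE.
Qed.

Section log_distribution_constraint.
Context {R : realType} {d : measure_display} {T : measurableType d}.
Context {P : probability T R} {m N : nat}.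
Variables (xi : 'I_m -> {RV P >-> R}) (g : 'I_m -> 'rV[R]_N -> R).
Local Notation F i := (rcdf (xi i)).
Local Notation Psi := (Psi xi g).

Lemma EFin_rcdf (Y : {RV P >-> R}) t : (rcdf Y t)%:E = cdf Y t.
Proof. by rewrite fineK// fin_num_measure. Qed.

Lemma rcdf_le1 (Y : {RV P >-> R}) t : rcdf Y t <= 1.
Proof. by rewrite -lee_fin EFin_rcdf cdf_le1. Qed.

Lemma rcdf_homo (Y : {RV P >-> R}) : {homo rcdf Y : s t / s <= t}.
Proof. by move=> s t st; rewrite -lee_fin !EFin_rcdf cdf_nondecreasing. Qed.

Lemma Psi_le_ln_rcdf x i : Psi x <= ln (F i (g i x)).
Proof.
rewrite /Psi (bigD1 i)//= gerDl sumr_le0// => j _.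
by rewrite ln_le0// rcdf_le1.
Qed.

Hypothesis F_gt0 : forall i t, 0 < F i t.

(** Independence turns the joint probability into the product of the marginal
    ones, whose logarithm is [Psi] because every factor is positive. *)
Lemma chance_problemE c X (p : R) : mutually_independent xi -> 0 < p ->
  chance_problem xi g c X p = level_problem c X Psi (ln p).
Proof.
move=> indep p0; congr MinProblem; apply/seteqP.
have feasE (x : 'rV[R]_N) :
    (p%:E <= P [set s | forall i, (xi i s <= g i x)%R])%E = (ln p <= Psi x).
  have -> : [set s | forall i, xi i s <= g i x] =
      \bigcap_(i in [set` [set: 'I_m]%SET]) xi i @^-1` `]-oo, g i x].
    apply/seteqP; split=> s /= H i.
      by move=> _; rewrite /= in_itv/=; exact: H.
    by have := H i; rewrite /= in_itv/= inE => /(_ isT).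
  rewrite (indep _ (fun i => `]-oo, g i x]%classic))//.
  under eq_bigr do rewrite -[P _]/(cdf _ _) -EFin_rcdf.
  rewrite prodEFin lee_fin -[LHS]ler_ln ?posrE ?prodr_gt0//.
  rewrite ln_prod_gt0//; congr (_ <= _).
  by apply: eq_bigl => i; rewrite inE.
by split=> x [Xx] /=; rewrite feasE.
Qed.

Variables (f : 'I_m -> R -> R) (r ts : 'I_m -> R) (X : set 'rV[R]_N).
Hypothesis F_derive : forall i (t : R), 0 < t -> is_derive t 1 (F i) (f i t).
Hypothesis r_gt0 : forall i, 0 < r i.
Hypothesis threshold : forall i, is_threshold (r i + 1) (f i) (ts i).
Hypothesis g_concave : forall i, alpha_concave (- r i)%:E X (g i).

(** Each factor of the joint probability is at least [p], hence larger than the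
    value of its distribution function at the threshold. *)
Lemma level_gt_threshold p x : \big[Num.max/0]_(i < m) F i (ts i) < p ->
  ln p <= Psi x -> forall i, ts i < g i x.
Proof.
move=> pstar px i; rewrite ltNge; apply/negP => gts.
have p0 : 0 < p by apply: le_lt_trans pstar; exact: bigmax_ge_id.
have pF : p <= F i (g i x).
  by rewrite -ler_ln ?posrE// (le_trans px)// Psi_le_ln_rcdf.
have Fts : F i (ts i) <= \big[Num.max/0]_(j < m) F j (ts j).
  exact: (le_bigmax _ (fun j => F j (ts j))).
have := le_lt_trans (le_trans pF (le_trans (rcdf_homo (xi i) gts) Fts)) pstar.
by rewrite ltxx.
Qed.

(** Each [F_i \o g_i] is concave above its threshold, and so is its logarithm,
    since the logarithm is increasing and concave. *)
Lemma Psi_concave_above x y l : X x -> X y ->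
  (forall i, ts i < g i x) -> (forall i, ts i < g i y) -> 0 <= l <= 1 ->
  l * Psi x + (1 - l) * Psi y <= Psi (l *: x + (1 - l) *: y).
Proof.
move=> Xx Xy tx ty l01; rewrite /Psi !mulr_sumr -big_split/=.
apply: ler_sum => i _; have /andP[l0 l1] := l01.
have := @concave_ln _ (Itv01 l0 l1) (F i (g i x)) (F i (g i y))
  (F_gt0 _ _) (F_gt0 _ _).
rewrite !convRE/= => /le_trans; apply.
have [ts0 _] := threshold i.
have Fle : l * F i (g i x) + (1 - l) * F i (g i y)
    <= F i (g i (l *: x + (1 - l) *: y)).
  apply: (@le_trans _ _ (F i (gen_mean (- r i)%:E (g i x) (g i y) l))).
    apply: (threshold_gen_mean_le (r_gt0 i) (threshold i)) => // t tst.
    by apply: F_derive; exact: lt_trans tst.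
  by apply: rcdf_homo; apply: (g_concave i).2.
rewrite ler_ln ?posrE//.
exact: (convR_gt0 (Itv01 l0 l1) (F_gt0 i (g i x)) (F_gt0 i (g i y))).
Qed.

Hypothesis X_convex : convex_set X.

Lemma level_convex p : \big[Num.max/0]_(i < m) F i (ts i) < p ->
  convex_set [set x | X x /\ ln p <= Psi x] /\
  concave_on [set x | X x /\ ln p <= Psi x] Psi.
Proof.
move=> pstar.
have conc x y l : X x /\ ln p <= Psi x -> X y /\ ln p <= Psi y -> 0 <= l <= 1 ->
    l * Psi x + (1 - l) * Psi y <= Psi (l *: x + (1 - l) *: y).
  move=> [Xx px] [Xy py] l01.
  by apply: Psi_concave_above => //; exact: level_gt_threshold pstar _.
split; last exact/concave_onP.
apply/convex_setP => x y l Dx Dy l01; split.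
  by move/convex_setP : X_convex; apply=> //; [case: Dx|case: Dy].
apply: le_trans (conc _ _ _ Dx Dy l01).
by case: Dx Dy l01 => [_ px] [_ py] /andP[l0 l1]; nra.
Qed.

Lemma convex_problem_level c tau : convex_set [set x | X x /\ tau <= Psi x] ->
  convex_problem (level_problem c X Psi tau).
Proof.
split=> // t x y _ _; rewrite convRE /= /conv/=.
by rewrite dotDr !dotZr.
Qed.

End log_distribution_constraint.

Section gradient.
Context {R : realType} {d : measure_display} {T : measurableType d}.
Context {P : probability T R} {m N : nat}.
Variables (xi : 'I_m -> {RV P >-> R}) (g : 'I_m -> 'rV[R]_N -> R).

Lemma Psi_differentiable (dF : 'I_m -> R) x :
  (forall i, 0 < rcdf (xi i) (g i x)) -> (forall i, differentiable (g i) x) ->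
  (forall i, is_derive (g i x) 1 (rcdf (xi i)) (dF i)) ->
  differentiable (Psi xi g) x /\
  grad (Psi xi g) x = \sum_i (dF i / rcdf (xi i) (g i x)) *: grad (g i) x.
Proof.
move=> F0 dg dF1.
pose L i := (fun t => ln (rcdf (xi i) t)).
have dL i : is_derive (g i x) 1 (L i) (dF i / rcdf (xi i) (g i x)).
  rewrite mulrC; apply: (@is_derive1_comp _ (@ln R) (rcdf (xi i))).
  exact: is_derive1_ln.
have dLd i : differentiable (L i) (g i x).
  by apply/derivable1_diffP; have [] := dL i.
have PsiE : Psi xi g = \sum_(i < m) (L i \o g i).
  by apply/funext => y; rewrite /Psi fct_sumE.
have dLg i : differentiable (L i \o g i) x by exact: differentiable_comp.
rewrite PsiE; split; first exact: differentiable_sum.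
apply/rowP => j; rewrite !mxE derive_sum; last first.
  by move=> i; exact: diff_derivable.
rewrite summxE; apply: eq_bigr => i _; rewrite !mxE.
have dLE w : 'd (L i) (g i x) w = w * (dF i / rcdf (xi i) (g i x)).
  rewrite -[w in LHS]mulr1 -[w * 1]/(w *: (1 : R)) linearZ -deriveE//.
  by have [_ ->] := dL i.
by rewrite deriveE// diff_comp// [LHS]dLE -deriveE// mulrC.
Qed.

End gradient.

(** * The chance-constrained problem *)

Theorem theorem8 (R : realType) (d : measure_display) (T : measurableType d)
    (P : probability T R) (m N : nat) (m_gt0 : (0 < m)%N) (N_gt0 : (0 < N)%N)
    (X : set 'rV[R]_N) (X_neq0 : X !=set0) (X_closed : closed X)
    (X_convex : convex_set X) (c : 'rV[R]_N)
    (lam chi psi phi r ts : 'I_m -> R) (xi : 'I_m -> {RV P >-> R})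
    (g : 'I_m -> 'rV[R]_N -> R)
    (xi_indep : mutually_independent xi)
    (params_adm : forall i, gig_admissible (lam i) (chi i) (psi i))
    (xi_GH : forall i, GH1_law (xi i) (lam i) (chi i) (psi i) 0 1 (phi i))
    (r_gt0 : forall i, 0 < r i)
    (params_abcd : forall i,
      [\/ 0 < psi i,
          psi i = 0 /\ phi i < 0,
          [/\ psi i = 0, 0 < phi i & r i < - lam i] |
          [/\ psi i = 0, phi i = 0, lam i < 0 & r i < - 2 * lam i] ])
    (g_concave : forall i, alpha_concave (- r i)%:E X (g i))
    (ts_threshold : forall i,
      is_threshold (r i + 1) (gh_pdf (lam i) (chi i) (psi i) (phi i)) (ts i)) :
  let f i := gh_pdf (lam i) (chi i) (psi i) (phi i) in
  let F i := rcdf (xi i) in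
  let Psi := Psi xi g in
  let v := value_fun c X Psi in
  let p_star := \big[Num.max/0]_(i < m) F i (ts i) in
  forall p : R, p_star < p -> p < 1 ->
  let D_p := [set x | X x /\ ln p <= Psi x] in
  let problem := level_problem c X Psi (ln p) in
  [/\ chance_problem xi g c X p = problem,
      convex_set D_p, concave_on D_p Psi & convex_problem problem] /\
  (forall U : set 'rV[R]_N, open U -> X `<=` U -> (forall i, C1_on U (g i)) ->
    [/\ forall x, U x -> (forall i, 0 < F i (g i x)) ->
          (forall i, gh_epdf (lam i) (chi i) (psi i) (phi i) (g i x)
                     \is a fin_num) ->
          differentiable Psi x /\
          grad Psi x = \sum_i (f i (g i x) / F i (g i x)) *: grad (g i) x,
        (exists2 x0, relint X x0 & ln p < Psi x0) ->
          forall xs, X xs ->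
            (optimal problem xs <-> exists ls, kkt c X Psi (ln p) xs ls) &
        forall dv, is_ederive v (ln p) dv ->
          0 <= dv /\
          forall xs, optimal problem xs ->
            (exists ls, kkt c X Psi (ln p) xs ls) /\
            (forall ls, kkt c X Psi (ln p) xs ls ->
               [/\ dv = ls, 0 <= ls,
                   is_ederive (fun q => v (ln q)) p (ls / p) &
                   0 <= ls / p]) ]).
Proof.
move=> f F Psi' v p_star p p_starp p1 D_p problem.
have F_gt0 i t : 0 < F i t by exact: GH1_rcdf_gt0 (xi_GH i) t.
have F_derive i (t : R) : 0 < t -> is_derive t 1 (F i) (f i t).
  move=> t0; apply: (is_derive_GH1_rcdf (xi_GH i)).
  by apply: (gh_epdf_fin_num (xi_GH i)); rewrite gt_eqF.
have p_star0 : 0 <= p_star by exact: bigmax_ge_id.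
have p0 : 0 < p by exact: le_lt_trans p_starp.
have level q : p_star < q -> convex_set [set x | X x /\ ln q <= Psi' x] /\
    concave_on [set x | X x /\ ln q <= Psi' x] Psi'.
  exact: (level_convex F_gt0 F_derive r_gt0 ts_threshold g_concave X_convex).
have [Dcvx Psi_ccv] := level p p_starp.
split; first by split=> //;
  [exact: chance_problemE|exact: convex_problem_level].
move=> U openU XU gC1.
have grad_Psi x : U x ->
    (forall i, gh_epdf (lam i) (chi i) (psi i) (phi i) (g i x) \is a fin_num) ->
    differentiable Psi' x /\
    grad Psi' x = \sum_i (f i (g i x) / F i (g i x)) *: grad (g i) x.
  move=> Ux fin; apply: Psi_differentiable => i.
  - exact: F_gt0.
  - by have [] := gC1 i x Ux.
  - exact: (is_derive_GH1_rcdf (xi_GH i) (fin i)).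
have diff_level x : X x -> ln p <= Psi' x -> differentiable Psi' x.
  move=> Xx px; have [] // := grad_Psi x (XU _ Xx).
  move=> i; apply: (gh_epdf_fin_num (xi_GH i)).
  have tsg := level_gt_threshold F_gt0 p_starp px i.
  by rewrite gt_eqF// (lt_trans _ tsg)//; case: (ts_threshold i).
split.
- by move=> x Ux _; exact: grad_Psi.
- move=> [x0 [Xx0 _] px0] xs Xxs; split=> [opt|[ls K]].
    apply: (kkt_necessary X_convex Psi_ccv Xx0 px0 Xxs _ opt).
    by apply: diff_level => //; case: opt => -[].
  apply: (kkt_optimal Psi_ccv Xxs _ K).
  by apply: diff_level => //; case: K.
- move=> dv dvP; split; first exact: value_fun_derive_ge0 dvP.
  move=> xs opt; have [[Xxs pxs] _] := opt.
  have dPsi := diff_level xs Xxs pxs.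
  split.
    have [x0 Xx0 px0] := value_fun_slater dvP.
    exact: (kkt_necessary X_convex Psi_ccv Xx0 px0 Xxs dPsi opt).
  move=> ls K; have [ls0 _ _ _] := K.
  (* a level below [ln p] at which [Psi] is still concave: it yields the
     affine minorant of the value function to the left of [ln p] *)
  pose q := (p_star + p) / 2.
  have p_starq : p_star < q by rewrite /q; lra.
  have qp : q < p by rewrite /q; lra.
  have lnqp : ln q < ln p.
    by rewrite ltr_ln ?posrE//; exact: le_lt_trans p_starq.
  have dvE : dv = ls.
    exact: (value_fun_derive_multiplier lnqp (level q p_starq).2
      Xxs dPsi opt K dvP).
  split=> //; last by rewrite divr_ge0// ltW.
  by rewrite -dvE; exact: is_ederive_comp_ln.
Qed.
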